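(* Let $(\Omega,\mathcal F_\infty)$ be a measurable space with a filtration $(\mathcal F_n)_{n\ge1}$ of sub-$\sigma$-fields of $\mathcal F_\infty$, and let $H_0,H_1$ be arbitrary (possibly empty) sets of probability measures on $(\Omega,\mathcal F_\infty)$. If $(H_0,H_1)$ is uniformly testable, then for every $\alpha\in(0,1)$ there exist a deterministic binary test $\psi^\alpha=(\psi^\alpha_n)_{n\ge1}$ and strictly increasing sample sizes $(m_k^\alpha)_{k\ge1}$ in $\mathbb N$ such that $$\rho(\psi^\alpha_n=1)\le\alpha\qquad\text{for all }\rho\in H_0,\ n\in\mathbb N,$$ and $$\sup_{\rho\in H_i}\rho\bigl(\exists n\ge m_K^\alpha:\ \psi_n^\alpha\ne i\bigr)\le\alpha\,2^{-K}$$ for every $i\in\{0,1\}$ with $H_i\ne\varnothing$ and every $K\in\mathbb N$. Consequently, $(H_0,H_1)$ is asymmetrically testable, and each $\psi^\alpha$ is also uniformly consistent and asymptotically consistent.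
   Context: $\mathbb N=\{1,2,\ldots\}$. The filtration satisfies $\mathcal F_1\subseteq\mathcal F_2\subseteq\cdots\subseteq\mathcal F_\infty$; it is not required that $\mathcal F_\infty=\sigma(\bigcup_n\mathcal F_n)$. No disjointness of $H_0$ and $H_1$ is assumed. A deterministic binary test is a sequence $\eta=(\eta_n)_{n\ge1}$ of maps $\eta_n:\Omega\to\{0,1\}$ such that $\eta_n$ is $\mathcal F_n$-measurable for each $n$ (with $\{0,1\}$ carrying the discrete $\sigma$-field). For $i\in\{0,1\}$, $\{\eta_n=i\text{ eventually}\}:=\bigcup_{N=1}^\infty\bigcap_{n=N}^\infty\{\eta_n=i\}$. Uniformly consistent (for $H_0$ against $H_1$): for every $\varepsilon>0$ there is $N\in\mathbb N$ such that for every $n\ge N$, every $i\in\{0,1\}$ and every $\rho\in H_i$, $\rho(\eta_n\ne i)<\varepsilon$. The pair $(H_0,H_1)$ is uniformly testable if a uniformly consistent deterministic binary test exists. Asymmetrically consistent at level $\alpha\in(0,1)$: $\rho(\eta_n=1)\le\alpha$ for all $\rho\in H_0$ and all $n\in\mathbb N$, and $\rho(\eta_n=1\text{ eventually})=1$ for all $\rho\in H_1$. The pair $(H_0,H_1)$ is asymmetrically testable if there is a family $(\psi^\alpha)_{\alpha\in(0,1)}$ of deterministic binary tests such that, for each $\alpha\in(0,1)$, $\psi^\alpha$ is asymmetrically consistent at level $\alpha$ (no compatibility across levels is required). Asymptotically consistent: $\rho(\eta_n=i\text{ eventually})=1$ for every $i\in\{0,1\}$ and every $\rho\in H_i$. 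*)

(* Defs.v *)
From mathcomp Require Import all_boot all_order all_algebra.
From mathcomp Require Import all_classical all_reals all_analysis.

Set Implicit Arguments.
Unset Strict Implicit.
Unset Printing Implicit Defensive.

Import Order.TTheory GRing.Theory Num.Theory.

Local Open Scope classical_set_scope.
Local Open Scope ring_scope.

(* Times range over {1, 2, ...}: every sequence below is indexed by nat, its
   value at 0 is irrelevant, and all quantifiers over times carry 1 <= n. *)

(* [measurable] plays the role of F_oo; it may be strictly larger than the
   sigma-algebra generated by the F n. *)
Definition filtration d (T : measurableType d) (F : nat -> set (set T)) :=
  [/\ forall n, (1 <= n)%N -> sigma_algebra setT (F n),
      forall n, (1 <= n)%N -> F n `<=` measurable &
      forall m n, (1 <= m)%N -> (m <= n)%N -> F m `<=` F n].

(* The values 0 and 1 are [false] and [true]; [bool] carries the discrete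
   sigma-algebra.  As [F n] is a sigma-algebra, the type
   [g_sigma_algebraType (F n)] is T equipped with [F n] itself. *)
Definition binary_test d (T : measurableType d) (F : nat -> set (set T))
    (eta : nat -> T -> bool) :=
  forall n, (1 <= n)%N ->
    measurable_fun [set: g_sigma_algebraType (F n)]
      (eta n : g_sigma_algebraType (F n) -> bool).

Definition hypothesis d (T : measurableType d) (R : realType)
    (H0 H1 : set (probability T R)) (i : bool) : set (probability T R) :=
  if i then H1 else H0.

Definition eventually_eq d (T : measurableType d) (eta : nat -> T -> bool)
    (i : bool) : set T :=
  \bigcup_(N in [set N | (1 <= N)%N])
    \bigcap_(n in [set n | (N <= n)%N]) [set w | eta n w = i].

Definition uniformly_consistent d (T : measurableType d) (R : realType)
    (H0 H1 : set (probability T R)) (eta : nat -> T -> bool) :=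
  forall eps : R, 0 < eps ->
    exists2 N, (1 <= N)%N &
      forall n, (N <= n)%N -> forall (i : bool) (rho : probability T R),
        hypothesis H0 H1 i rho ->
        (rho [set w | eta n w <> i] < eps%:E)%E.

Definition uniformly_testable d (T : measurableType d) (R : realType)
    (F : nat -> set (set T)) (H0 H1 : set (probability T R)) :=
  exists eta, binary_test F eta /\ uniformly_consistent H0 H1 eta.

Definition level_bound d (T : measurableType d) (R : realType)
    (H0 : set (probability T R)) (alpha : R) (eta : nat -> T -> bool) :=
  forall rho : probability T R, H0 rho -> forall n, (1 <= n)%N ->
    (rho [set w | eta n w = true] <= alpha%:E)%E.

Definition asymmetrically_consistent d (T : measurableType d) (R : realType)
    (H0 H1 : set (probability T R)) (alpha : R) (eta : nat -> T -> bool) :=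
  level_bound H0 alpha eta /\
  forall rho : probability T R, H1 rho -> rho (eventually_eq eta true) = 1%E.

Definition asymmetrically_testable d (T : measurableType d) (R : realType)
    (F : nat -> set (set T)) (H0 H1 : set (probability T R)) :=
  exists psi : R -> nat -> T -> bool,
    forall alpha : R, 0 < alpha < 1 ->
      binary_test F (psi alpha) /\
      asymmetrically_consistent H0 H1 alpha (psi alpha).

Definition asymptotically_consistent d (T : measurableType d) (R : realType)
    (H0 H1 : set (probability T R)) (eta : nat -> T -> bool) :=
  forall (i : bool) (rho : probability T R), hypothesis H0 H1 i rho ->
    rho (eventually_eq eta i) = 1%E.

Definition sample_sizes (m : nat -> nat) :=
  (forall k, (1 <= k)%N -> (1 <= m k)%N) /\
  (forall k l, (1 <= k)%N -> (k < l)%N -> (m k < m l)%N).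

Definition late_error d (T : measurableType d) (psi : nat -> T -> bool)
    (i : bool) (M : nat) : set T :=
  [set w | exists2 n, (M <= n)%N & psi n w <> i].

(* Main.v *)
Require Import Defs.
From mathcomp Require Import all_boot all_order all_algebra.
From mathcomp Require Import all_classical all_reals all_analysis.

Import Order.TTheory GRing.Theory Num.Theory.

Local Open Scope classical_set_scope.
Local Open Scope ring_scope.

(** Uniform consistency bounds the error of [eta] at each single time, but says
    nothing about the union of the errors over all late times.  The remedy is to
    consult [eta] rarely.  Pick sample sizes [m 1 < m 2 < ...] such that the
    error of [eta] at time [m k] is below [alpha / 2 ^ k.+1] uniformly over both
    hypotheses ([uniform_sample_sizes]), and let the new test repeat, at every
    time [n], the verdict of [eta] at the last sample size not exceeding [n],
    answering 0 before [m 1] ([blocked_test]).  It looks only at the past, so it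
    is still adapted.

    An error of the new test at some time [n >= m K] is an error of [eta] at
    some [m k] with [k >= K], so countable subadditivity bounds its probability
    by the sum of [alpha / 2 ^ k.+1] over [k >= K], that is by [alpha / 2 ^ K]
    ([late_error_blocked_test_le]).  Everything else follows from this bound.
    The level is respected because the test makes no type I error before [m 1],
    and errs after [m 1] with probability at most [alpha / 2].  Uniform and
    asymptotic consistency hold for any test whose late errors vanish uniformly
    ([vanishing_late_error_consistent]), and asymptotic consistency under [H1]
    is the second half of asymmetric consistency. *)

(** The search range [k < n.+1] loses nothing when [k <= m k].  With the
    convention [m 0 = 0] the index 0 is always admissible, and stage 0 means
    that the first sample size has not been reached. *)
Definition stage (m : nat -> nat) (n : nat) : nat :=
  (\max_(k < n.+1 | (m k <= n)%N) k)%N.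

Lemma stage_leq (m : nat -> nat) (n : nat) :
  m 0%N = 0%N -> (m (stage m n) <= n)%N.
Proof.
move=> m0; apply: (big_ind (fun k => m k <= n)%N) => [|x y mx my|//].
  by rewrite m0.
by rewrite /maxn; case: ifP.
Qed.

Lemma leq_stage (m : nat -> nat) (n K : nat) :
  (forall k, k <= m k)%N -> (m K <= n)%N -> (K <= stage m n)%N.
Proof.
move=> mk mKn; have Kn : (K < n.+1)%N by rewrite ltnS (leq_trans (mk K)).
exact: (leq_bigmax_cond (Ordinal Kn)).
Qed.

Definition blocked_test {T : Type} (m : nat -> nat) (eta : nat -> T -> bool)
    (n : nat) (w : T) : bool :=
  (0 < stage m n)%N && eta (m (stage m n)) w.

(** Adaptedness is stated over the sigma-algebra generated by [F n]; for
    probabilities to make sense, the events must be measurable in the ambient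
    sigma-algebra, which contains it. *)
Lemma binary_test_measurable {d} {T : measurableType d} {F : nat -> set (set T)}
    {eta : nat -> T -> bool} (P : set bool) (n : nat) :
  filtration F -> binary_test F eta -> (1 <= n)%N ->
  measurable (eta n @^-1` P).
Proof.
move=> [_ FT _] eta_test n1.
suff : <<s F n >> (eta n @^-1` P).
  exact: (smallest_sub (@sigma_algebra_measurable _ T) (FT n n1)).
by rewrite -[X in <<s _ >> X]setTI; apply: (eta_test n n1).
Qed.

(** At time [n] the blocked test is [eta] at the earlier time [m (stage m n)],
    or a constant; monotonicity of the filtration does the rest. *)
Lemma blocked_test_adapted {d} {T : measurableType d} {F : nat -> set (set T)}
    {eta : nat -> T -> bool} (m : nat -> nat) :
  filtration F -> binary_test F eta -> m 0%N = 0%N ->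
  (forall k, k <= m k)%N -> binary_test F (blocked_test m eta).
Proof.
move=> [_ _ FF] eta_test m0 mk n n1; rewrite /blocked_test.
case: (posnP (stage m n)) => [s0|s_gt0] /=; first exact: measurable_cst.
have ms1 : (1 <= m (stage m n))%N by exact: leq_trans s_gt0 (mk _).
move=> _ B _.
apply: (@sub_sigma_algebra2 _ setT (F n) (F (m (stage m n)))).
  exact: FF ms1 (stage_leq m n m0).
exact: (eta_test _ ms1).
Qed.

Lemma late_error_measurable {d} {T : measurableType d} {F : nat -> set (set T)}
    {psi : nat -> T -> bool} (i : bool) (M : nat) :
  filtration F -> binary_test F psi -> (1 <= M)%N ->
  measurable (late_error psi i M).
Proof.
move=> Ffilt psi_test M1.
rewrite (_ : late_error psi i M =
  \bigcup_(n in [set n | (M <= n)%N]) (psi n @^-1` [set b | b <> i])).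
  apply: bigcup_measurable => n /= Mn.
  exact: binary_test_measurable Ffilt psi_test (leq_trans M1 Mn).
by apply/seteqP; split=> w [n]; exists n.
Qed.

(** After time [m K] the blocked test only ever displays verdicts of [eta] at
    the times [m k] with [K <= k], so a late error is an error of [eta] at one
    of them; the infinitely many times [n >= m K] collapse to one event per
    stage. *)
Lemma late_error_blocked_test_sub {d} {T : measurableType d} (m : nat -> nat)
    (eta : nat -> T -> bool) (i : bool) (K : nat) :
  (forall k, k <= m k)%N -> (1 <= K)%N ->
  late_error (blocked_test m eta) i (m K) `<=`
  \bigcup_j [set w | eta (m (K + j)%N) w <> i].
Proof.
move=> mk K1 w /= [n mKn]; have Ks := leq_stage m n K mk mKn.
rewrite /blocked_test (leq_trans K1 Ks) /= => err.
by exists (stage m n - K)%N => //=; rewrite subnKC.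
Qed.

(** The exponent [k.+1] in the hypothesis, rather than [k], makes the geometric
    tail from [K] on sum to [alpha / 2 ^ K] exactly. *)
Lemma late_error_blocked_test_le {d} {T : measurableType d} {R : realType}
    {F : nat -> set (set T)} {eta : nat -> T -> bool} {m : nat -> nat}
    (rho : probability T R) (i : bool) (alpha : R) (K : nat) :
  filtration F -> binary_test F eta -> m 0%N = 0%N ->
  (forall k, k <= m k)%N -> 0 <= alpha ->
  (forall k, (1 <= k)%N ->
     (rho [set w | eta (m k) w <> i] <= (alpha / 2 ^+ k.+1)%:E)%E) ->
  (1 <= K)%N ->
  (rho (late_error (blocked_test m eta) i (m K)) <= (alpha * 2 ^- K)%:E)%E.
Proof.
move=> Ffilt eta_test m0 mk alpha0 err K1.
have psi_test := blocked_test_adapted m Ffilt eta_test m0 mk.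
have m1 k : (1 <= k)%N -> (1 <= m k)%N by move=> k1; exact: leq_trans k1 (mk k).
have K1j j : (1 <= K + j)%N by rewrite (leq_trans K1) ?leq_addr.
apply: (@le_trans _ _
  (\sum_(0 <= j <oo) rho [set w | eta (m (K + j)%N) w <> i])%E).
  apply: measure_sigma_subadditive.
  - move=> j; apply: (binary_test_measurable [set b | b <> i]) Ffilt eta_test _.
    exact: m1.
  - exact: late_error_measurable Ffilt psi_test (m1 _ K1).
  - exact: late_error_blocked_test_sub.
have aK0 : 0 <= alpha * 2 ^- K by rewrite mulr_ge0 ?invr_ge0 ?exprn_ge0.
apply: le_trans (epsilon_trick0 xpredT aK0).
apply: lee_nneseries => [//|j _].
apply: le_trans (err _ (K1j j)) _.
by rewrite lee_fin natrX -mulrA -invfM -exprD addnS.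
Qed.

(** A wrong verdict at time [n >= M] is a late error from [M] on, which gives
    uniform consistency.  If the verdicts are not eventually [i], there is a
    late error from every [M] on, so the probability of that event is below every
    [eps]. *)
Lemma vanishing_late_error_consistent {d} {T : measurableType d} {R : realType}
    {F : nat -> set (set T)} {H0 H1 : set (probability T R)}
    {psi : nat -> T -> bool} :
  filtration F -> binary_test F psi ->
  (forall eps : R, 0 < eps -> exists2 M, (1 <= M)%N &
     forall (i : bool) (rho : probability T R), hypothesis H0 H1 i rho ->
       (rho (late_error psi i M) < eps%:E)%E) ->
  uniformly_consistent H0 H1 psi /\ asymptotically_consistent H0 H1 psi.
Proof.
move=> Ffilt psi_test small; split=> [eps eps0|i rho Hrho].
  have [M M1 errM] := small eps eps0; exists M => // n Mn i rho Hrho.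
  apply: le_lt_trans (errM i rho Hrho); apply: le_measure; rewrite ?inE.
  - exact: (binary_test_measurable [set b | b <> i]) Ffilt psi_test
      (leq_trans M1 Mn).
  - exact: late_error_measurable Ffilt psi_test M1.
  - by move=> w ?; exists n.
have mev : measurable (eventually_eq psi i).
  apply: bigcup_measurable => N /= N1; apply: bigcap_measurable => [|n /= Nn].
    by exists N => /=.
  exact: (binary_test_measurable [set i]) Ffilt psi_test (leq_trans N1 Nn).
apply/eqP; rewrite eq_le probability_le1 //=.
apply/lee_addgt0Pr => eps eps0.
have [M M1 errM] := small eps eps0.
have mM := late_error_measurable i M Ffilt psi_test M1.
rewrite addeC -leeBlDr ?fin_num_measure // -probability_setC //.
apply: le_trans (ltW (errM i rho Hrho)); apply: le_measure; rewrite ?inE //.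
  exact: measurableC.
move=> w nev; apply: contrapT => nlate; apply: nev; exists M => // n /= Mn.
by apply: contrapT => err; apply: nlate; exists n.
Qed.

(** Each [m k.+1] is the larger of the threshold supplied by uniform consistency
    for [e k.+1] and the successor of [m k]; the value [m 0 = 0] carries no
    error bound. *)
Lemma uniform_sample_sizes {d} {T : measurableType d} {R : realType}
    {H0 H1 : set (probability T R)} {eta : nat -> T -> bool} (e : nat -> R) :
  uniformly_consistent H0 H1 eta -> (forall k, 0 < e k) ->
  exists m : nat -> nat, [/\ m 0%N = 0%N, (forall k, m k < m k.+1)%N &
    forall k, (1 <= k)%N -> forall (i : bool) (rho : probability T R),
      hypothesis H0 H1 i rho -> (rho [set w | eta (m k) w <> i] < (e k)%:E)%E].
Proof.
move=> unif e0.
have /choice[N errN] : forall k, exists N, forall n, (N <= n)%N ->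
    forall (i : bool) (rho : probability T R), hypothesis H0 H1 i rho ->
    (rho [set w | eta n w <> i] < (e k)%:E)%E.
  by move=> k; have [N _ errN] := unif _ (e0 k); exists N.
pose m := fix m k := if k is k'.+1 then maxn (m k').+1 (N k) else 0%N.
exists m; split=> [//|k|[//|k] _ i rho Hrho]; first exact: leq_maxl.
by apply: errN Hrho; exact: leq_maxr.
Qed.

Lemma blocked_test_exists {d} {T : measurableType d} {R : realType}
    {F : nat -> set (set T)} {H0 H1 : set (probability T R)} (alpha : R) :
  filtration F -> uniformly_testable F H0 H1 -> 0 < alpha ->
  exists (psi : nat -> T -> bool) (m : nat -> nat),
    [/\ binary_test F psi, sample_sizes m,
        forall n w, (n < m 1%N)%N -> psi n w = false &
        forall (i : bool) (rho : probability T R), hypothesis H0 H1 i rho ->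
          forall K, (1 <= K)%N ->
            (rho (late_error psi i (m K)) <= (alpha * 2 ^- K)%:E)%E].
Proof.
move=> Ffilt [eta [eta_test unif]] alpha0.
have e0 (k : nat) : 0 < alpha / 2 ^+ k.+1 by rewrite divr_gt0 ?exprn_gt0.
have [m [m0 mS err]] := uniform_sample_sizes _ unif e0.
have m_ltn : {homo m : k l / (k < l)%N} by exact: (homo_ltn ltn_trans).
have mk k : (k <= m k)%N by elim: k => // k /leq_ltn_trans; apply.
exists (blocked_test m eta), m; split.
- exact: blocked_test_adapted.
- by split=> [k k1|k l _]; [exact: leq_trans k1 (mk k)|exact: m_ltn].
- move=> n w nm1; rewrite /blocked_test.
  have [-> //|s1] := posnP (stage m n).
  have : (m 1%N <= m (stage m n))%N.
    by move: s1; rewrite leq_eqVlt => /predU1P[<-//|/m_ltn/ltnW].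
  by move=> /leq_trans /(_ (stage_leq m n m0)); rewrite leqNgt nm1.
- move=> i rho Hrho K K1.
  apply: (late_error_blocked_test_le rho i alpha K Ffilt eta_test m0 mk) => //.
    exact: ltW.
  by move=> k k1; apply/ltW; apply: err.
Qed.

Theorem corollary3p2 (d : measure_display) (T : measurableType d)
    (R : realType) (F : nat -> set (set T)) (H0 H1 : set (probability T R)) :
  filtration F ->
  uniformly_testable F H0 H1 ->
  (forall alpha : R, 0 < alpha < 1 ->
     exists (psi : nat -> T -> bool) (m : nat -> nat),
       [/\ binary_test F psi /\ sample_sizes m,
           level_bound H0 alpha psi,
           forall i : bool, hypothesis H0 H1 i !=set0 ->
             forall K : nat, (1 <= K)%N ->
               (ereal_sup [set rho (late_error psi i (m K))
                          | rho in hypothesis H0 H1 i]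
                  <= (alpha * 2 ^- K)%:E)%E,
           uniformly_consistent H0 H1 psi &
           asymptotically_consistent H0 H1 psi]) /\
  asymmetrically_testable F H0 H1.
Proof.
move=> Ffilt test.
(* The tests of the first part, one chosen for each level, witness asymmetric
   testability; outside ]0, 1[ any sequence of maps will do. *)
set main := (X in X /\ _).
suff main_holds : main.
  split=> //.
  have /choice[psi psiP] : forall alpha : R, exists psi : nat -> T -> bool,
      0 < alpha < 1 ->
      binary_test F psi /\ asymmetrically_consistent H0 H1 alpha psi.
    move=> alpha; have [a01|/negP na01] := boolP (0 < alpha < 1); last first.
      by exists (fun _ _ => false).
    have [psi [m [[psi_test _] lvl _ _ asym]]] := main_holds alpha a01.
    by exists psi => _; split=> //; split=> // rho; exact: (asym true).
  by exists psi.
move=> alpha /andP[alpha0 _].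
have [psi [m [psi_test ms psi0 late]]] :=
  blocked_test_exists alpha Ffilt test alpha0.
have [m1 _] := ms.
exists psi, m.
have [] := @vanishing_late_error_consistent _ _ R F H0 H1 psi Ffilt psi_test.
  (* The archimedean bound on [alpha / eps] is a stage at which [alpha / 2 ^ K]
     has dropped below [eps]. *)
  move=> eps eps0; set K := (Num.bound (alpha / eps)).+1.
  exists (m K) => [|i rho Hrho]; first exact: m1.
  apply: le_lt_trans (late i rho Hrho K _) _ => //.
  rewrite lte_fin ltr_pdivrMr ?exprn_gt0 // mulrC -ltr_pdivrMr //.
  exact: upper_nthrootP.
split=> //.
- move=> rho H0rho n n1; have [nm1|m1n] := ltnP n (m 1%N).
    rewrite (_ : [set w | _] = set0) ?measure0 ?lee_fin ?ltW //.
    by rewrite -subset0 => w /=; rewrite psi0.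
  apply: (@le_trans _ _ (rho (late_error psi false (m 1%N)))).
    apply: le_measure; rewrite ?inE.
    + exact: (binary_test_measurable [set true]) Ffilt psi_test n1.
    + exact: late_error_measurable Ffilt psi_test (m1 1%N isT).
    + by move=> w /= psi1; exists n => //; rewrite psi1.
  apply: le_trans (late false rho H0rho 1%N isT) _.
  by rewrite lee_fin ler_piMr ?ltW // invf_lt1 ?ltr1n ?expr1.
- move=> i _ K K1; apply: ge_ereal_sup => _ [rho Hrho <-].
  exact: late.
Qed.
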